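(* Let $n\geq1$, let $N_i\subset\{1,\dots,n\}$ and $w^i\in\mathbb{R}_+^n$ be such that $i\in N_i$ and $\mathrm{supp}(w^i)=N_i$ for each $i\in\{1,\dots,n\}$, and let $\lambda>0$. Assume that there exist $i,j$ such that $N_i \neq N_j$ and $N_i \cap N_j \neq \varnothing$. (1) Let $f:\mathbb{R}^n\to\mathbb{R}^n$ be the WG-LASSO shrinkage, $f_{i}(y) := y_{i} \left(1-\frac{\lambda}{\|\mathrm{diag}(w^{i}) y\|_{2}}\right)_{+}$ for each $i$. There is no penalty $\varphi:\mathbb{R}^n\to\mathbb{R}\cup\{+\infty\}$ such that $f = \mathrm{prox}_\varphi$ (i.e. such that $f$ is a proximity operator of $\varphi$). (2) Let $f:\mathbb{R}^n\to\mathbb{R}^n$ be the PEW shrinkage, $f_{i}(y) := y_{i} \left(1-\frac{\lambda^{2}}{\|\mathrm{diag}(w^{i}) y\|_{2}^{2}}\right)_{+}$ for each $i$. There is no penalty $\varphi:\mathbb{R}^n\to\mathbb{R}\cup\{+\infty\}$ such that $f = \mathrm{prox}_\varphi$ (i.e. such that $f$ is a proximity operator of $\varphi$).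
   Context: $(t)_+=\max(t,0)$; $\mathrm{diag}(w)$ is the diagonal matrix with diagonal $w$; $\mathrm{supp}(w)=\{\ell:w_\ell\neq0\}$; when $\|\mathrm{diag}(w^i)y\|_2=0$ (which forces $y_i=0$) one sets $f_i(y)=0$. $\mathrm{prox}_\varphi(y) := \arg\min_{x \in \mathbb{R}^n} \{\tfrac12\|y-x\|_2^2 + \varphi(x)\}$ is the set of global minimizers (a minimizer is required to have finite objective value, so the set is empty if $\varphi\equiv+\infty$); $f$ is a proximity operator of $\varphi$ if $f(y)\in\mathrm{prox}_\varphi(y)$ for all $y\in\mathbb{R}^n$. *)

(* Defs.v *)
From HB Require Import structures.
From mathcomp Require Import all_boot all_order all_algebra.
From mathcomp Require Import all_classical all_reals.

Set Implicit Arguments.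
Unset Strict Implicit.
Unset Printing Implicit Defensive.

Import Order.TTheory GRing.Theory Num.Theory.
Local Open Scope ring_scope.

(* The norm that the library puts on matrices is the sup norm, hence an explicit
   Euclidean norm. *)
Definition norm2 (R : realType) (n : nat) (x : 'cV[R]_n) : R :=
  Num.sqrt (\sum_(l < n) x l 0 ^+ 2).

Definition supp (R : realType) (n : nat) (w : 'cV[R]_n) : {set 'I_n} :=
  [set l | w l 0 != 0]%SET.

Definition pos_part (R : realType) (t : R) : R := Num.max t 0.

Definition dweight (R : realType) (n : nat) (w : 'cV[R]_n) : 'M[R]_n :=
  diag_mx w^T.

(* Penalties with values in R u {+oo}: the extended reals without -oo. The
   function identically +oo is allowed. *)
Definition penalty (R : realType) (n : nat) (phi : 'cV[R]_n -> \bar R) : Prop :=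
  forall x, phi x <> -oo%E.

Definition prox_objective (R : realType) (n : nat) (phi : 'cV[R]_n -> \bar R)
    (y x : 'cV[R]_n) : \bar R :=
  ((2^-1 * norm2 (y - x) ^+ 2)%:E + phi x)%E.

(* Set-valued: the finiteness condition makes this set empty when phi is
   identically +oo. *)
Definition prox (R : realType) (n : nat) (phi : 'cV[R]_n -> \bar R)
    (y : 'cV[R]_n) : set 'cV[R]_n :=
  [set x | prox_objective phi y x \is a fin_num /\
           forall z, (prox_objective phi y x <= prox_objective phi y z)%E]%classic.

Definition is_prox_of (R : realType) (n : nat) (f : 'cV[R]_n -> 'cV[R]_n)
    (phi : 'cV[R]_n -> \bar R) : Prop :=
  forall y, prox phi y (f y).

Definition wg_lasso (R : realType) (n : nat) (w : 'I_n -> 'cV[R]_n) (lambda : R)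
    (y : 'cV[R]_n) : 'cV[R]_n :=
  \col_i (if norm2 (dweight (w i) *m y) == 0 then 0
          else y i 0 * pos_part (1 - lambda / norm2 (dweight (w i) *m y))).

Definition pew (R : realType) (n : nat) (w : 'I_n -> 'cV[R]_n) (lambda : R)
    (y : 'cV[R]_n) : 'cV[R]_n :=
  \col_i (if norm2 (dweight (w i) *m y) == 0 then 0
          else y i 0 *
               pos_part (1 - lambda ^+ 2 / norm2 (dweight (w i) *m y) ^+ 2)).

(* Main.v *)
(** If [f] is a proximity operator of some penalty then [f y] is a subgradient
    at [y] of a finite convex function [psi].  On a rectangle in the plane of the
    coordinates [i] and [j], the mixed second difference of [psi] can be
    estimated both from the variation of [f_i] along [e_j] and from the variation
    of [f_j] along [e_i].  If [i] is in [N_j], the latter is bounded below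
    independently of the coordinates outside [N_j].  The former vanishes if [j]
    is not in [N_i], and tends to [0] as the coordinates outside [N_j] grow if
    [N_i] is not included in [N_j].  So [i \in N_j] forces [N_i = N_j], and two
    overlapping neighbourhoods coincide. *)
Require Import Defs.
From mathcomp Require Import all_boot all_order all_algebra.
From mathcomp Require Import all_classical all_reals.
From mathcomp Require Import ring lra.
Import Order.TTheory GRing.Theory Num.Theory.
Local Open Scope ring_scope.

Set Implicit Arguments.
Unset Strict Implicit.
Unset Printing Implicit Defensive.

(** * Convexity: subgradients and mixed second differences *)

Lemma norm2_sqr (R : realType) (n : nat) (x : 'cV[R]_n) :
  norm2 x ^+ 2 = \sum_l x l 0 ^+ 2.
Proof. by rewrite sqr_sqrtr // sumr_ge0 // => l _; exact: sqr_ge0. Qed.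

(** Up to sign and the term [norm2 y ^+ 2 / 2], [psi y] is the minimal value of the objective.
    Expanding the square makes [psi] the convex conjugate of [phi] plus half the squared norm; the
    supremum at [y] is attained at [f y], which is thus a subgradient. *)
Lemma prox_subgradient (R : realType) (n : nat) (f : 'cV[R]_n -> 'cV[R]_n)
    (phi : 'cV[R]_n -> \bar R) :
  is_prox_of f phi ->
  exists psi : 'cV[R]_n -> R, forall y z : 'cV[R]_n,
    psi y + \sum_l f y l 0 * (z l 0 - y l 0) <= psi z.
Proof.
move=> fphi.
have phi_fin y : phi (f y) \is a fin_num.
  by have [+ _] := fphi y; rewrite /prox_objective fin_numD => /andP[].
exists (fun y => 2^-1 * norm2 y ^+ 2
  - (2^-1 * norm2 (y - f y) ^+ 2 + fine (phi (f y)))) => y z.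
have [_ /(_ (f y))] := fphi z.
rewrite /prox_objective -(fineK (phi_fin y)) -(fineK (phi_fin z)) -!EFinD lee_fin.
have -> : \sum_l f y l 0 * (z l 0 - y l 0) =
    2^-1 * norm2 z ^+ 2 - 2^-1 * norm2 y ^+ 2
    - 2^-1 * norm2 (z - f y) ^+ 2 + 2^-1 * norm2 (y - f y) ^+ 2.
  rewrite !norm2_sqr !mulr_sumr -!sumrB -big_split /=.
  by apply: eq_bigr => l _; rewrite !mxE; field.
by lra.
Qed.

Lemma ler_archimedean (R : realType) (x y K : R) :
  (forall m : nat, x <= y + K / m.+1%:R) -> x <= y.
Proof.
move=> H; rewrite leNgt; apply/negP => yx.
have d0 : 0 < x - y by rewrite subr_gt0.
pose k := Num.bound `|K / (x - y)|.
have Kb : K / (x - y) < k.+1%:R.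
  apply: le_lt_trans (ler_norm _) (lt_trans (archi_boundP (normr_ge0 _)) _).
  by rewrite ltr_nat.
have := H k; move: Kb.
set m := _.+1; have m0 : 0 < m%:R :> R by rewrite ltr0n.
rewrite ltr_pdivrMr // => Kb; rewrite -lerBlDl ler_pdivlMr // leNgt.
by rewrite [(_ - _) * _]mulrC Kb.
Qed.

(* On a subdivision of step [d], the increment of [u] is bounded by the upper
   Riemann sum of [p] and that of [v] by the lower Riemann sum of [q]; shifting
   the index costs the telescoping term [(q b - q a) * d]. *)
Lemma subgradient_comparison (R : realType) (u v p q : R -> R) (a b c : R) :
  a <= b ->
  (forall s t, u s + p s * (t - s) <= u t) ->
  (forall s t, v s + q s * (t - s) <= v t) ->
  (forall s, a <= s <= b -> p s - q s <= c) ->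
  (u b - u a) - (v b - v a) <= c * (b - a).
Proof.
move=> ab up vq pq.
apply: (@ler_archimedean R _ _ ((q b - q a) * (b - a))) => m.
set d := (b - a) / m.+1%:R.
have m0 : m.+1%:R != 0 :> R by rewrite pnatr_eq0.
have d0 : 0 <= d by rewrite divr_ge0 // subr_ge0.
have dm : m.+1%:R * d = b - a by rewrite mulrC divfK.
have step k : (k <= m.+1)%N ->
    (u (a + k%:R * d) - u a) - (v (a + k%:R * d) - v a) <=
    k%:R * (c * d) + (q (a + k%:R * d) - q a) * d.
  elim: k => [|k IH] km; first by rewrite !mul0r !addr0; lra.
  have kd : k.+1%:R * d = k%:R * d + d by rewrite -natr1 mulrDl mul1r.
  have := IH (ltnW km); set s := a + k%:R * d; set t := a + k.+1%:R * d.
  have tE : t = s + d by rewrite /t kd /s addrA.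
  have t_in : a <= t <= b.
    by rewrite lerDl mulr_ge0 //= -lerBrDl -dm ler_wpM2r // ler_nat.
  have := pq t t_in; have := up t s; have := vq s t.
  have -> : s - t = - d by rewrite tE; ring.
  have -> : t - s = d by rewrite tE; ring.
  move=> H1 H2 /(ler_wpM2r d0) H3 H4.
  by rewrite -natr1; lra.
have := step m.+1 (leqnn _).
rewrite dm (_ : a + (b - a) = b); last by ring.
by rewrite mulrCA dm /d mulrA.
Qed.

(** Both sides are compared with the mixed second difference of [F] over the rectangle: the edges in
    direction [s] bound it above through [P], those in direction [t] bound it below through [Q]. *)
Lemma subgradient_rectangle (R : realType) (F P Q : R -> R -> R)
    (s0 s1 t0 t1 cP cQ : R) :
  s0 <= s1 -> t0 <= t1 ->
  (forall s t s' t', F s t + (P s t * (s' - s) + Q s t * (t' - t)) <= F s' t') ->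
  (forall s, s0 <= s <= s1 -> P s t1 - P s t0 <= cP) ->
  (forall t, t0 <= t <= t1 -> cQ <= Q s1 t - Q s0 t) ->
  cQ * (t1 - t0) <= cP * (s1 - s0).
Proof.
move=> s01 t01 FPQ hP hQ.
have FP t s s' : F s t + P s t * (s' - s) <= F s' t.
  by have := FPQ s t s' t; rewrite subrr mulr0 addr0.
have FQ s t t' : F s t + Q s t * (t' - t) <= F s t'.
  by have := FPQ s t s t'; rewrite subrr mulr0 add0r.
have := subgradient_comparison s01 (FP t1) (FP t0) hP.
(* The comparison only bounds from above, so the two edges are exchanged to get the lower bound. *)
have hQ' t : t0 <= t <= t1 -> Q s0 t - Q s1 t <= - cQ.
  by move=> /hQ; lra.
have := subgradient_comparison t01 (FQ s0) (FQ s1) hQ'.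
by lra.
Qed.

(** * Shrinkage factors as functions of the squared weighted norm *)

Definition energy (R : realType) (n : nat) (w y : 'cV[R]_n) : R :=
  \sum_l (w l 0 * y l 0) ^+ 2.

Lemma norm2_dweight (R : realType) (n : nat) (w y : 'cV[R]_n) :
  norm2 (dweight w *m y) = Num.sqrt (energy w y).
Proof.
by congr Num.sqrt; apply: eq_bigr => l _; rewrite mul_diag_mx !mxE.
Qed.

(** Common form of both shrinkage factors: [e = 1] gives WG-LASSO, [e = 2] gives PEW. *)
Definition gain (R : realType) (e : nat) (lambda t : R) : R :=
  if Num.sqrt t == 0 then 0
  else pos_part (1 - lambda ^+ e / Num.sqrt t ^+ e).

Section Gain.
Variables (R : realType) (e : nat) (lambda : R).
Hypotheses (e_gt0 : (0 < e)%N) (lambda_gt0 : 0 < lambda).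

Lemma gain_le1 (t : R) : gain e lambda t <= 1.
Proof.
rewrite /gain; case: ifP => // _; rewrite ge_max ler01 andbT lerBlDr lerDl.
by rewrite divr_ge0 // exprn_ge0 ?sqrtr_ge0 // ltW.
Qed.

Lemma gain_lt (t t' : R) : lambda ^+ 2 <= t -> t < t' ->
  gain e lambda t < gain e lambda t'.
Proof.
move=> lt tt'.
have t0 : 0 < t by apply: lt_le_trans lt; rewrite exprn_gt0.
have t'0 : 0 < t' by apply: lt_trans tt'.
have ls : lambda <= Num.sqrt t.
  by rewrite -(ger0_norm (ltW lambda_gt0)) -sqrtr_sqr ler_wsqrtr.
have ss : Num.sqrt t < Num.sqrt t' by rewrite ltr_sqrt.
have s0 : 0 < Num.sqrt t by rewrite sqrtr_gt0.
have s'0 : 0 < Num.sqrt t' by rewrite sqrtr_gt0.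
have quot : lambda ^+ e / Num.sqrt t' ^+ e < lambda ^+ e / Num.sqrt t ^+ e.
  rewrite ltr_pM2l ?exprn_gt0 // ltf_pV2 ?posrE ?exprn_gt0 //.
  by rewrite ltrXn2r -?lt0n // ltW.
have quot1 : lambda ^+ e / Num.sqrt t ^+ e <= 1.
  by rewrite ler_pdivrMr ?exprn_gt0 // mul1r lerXn2r // nnegrE ltW.
rewrite /gain !gt_eqF // /pos_part !max_l ?subr_ge0 //.
- by rewrite ltrD2l ltrN2.
- by rewrite ltW // (lt_le_trans quot).
Qed.

Lemma gain_near1 (eps : R) : 0 < eps ->
  exists2 T : R, 0 < T & forall t : R, T <= t -> 1 - eps <= gain e lambda t.
Proof.
(* The cap at [1] ensures that raising [lambda / Num.sqrt t <= r] to the power [e] does not increase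
   it. *)
move=> eps0; pose r := Num.min eps 1; pose S := lambda / r.
have r0 : 0 < r by rewrite lt_min eps0 ltr01.
have S0 : 0 < S by rewrite divr_gt0.
exists (S ^+ 2) => [|t St]; first by rewrite exprn_gt0.
have SS : S <= Num.sqrt t.
  by rewrite -(ger0_norm (ltW S0)) -sqrtr_sqr ler_wsqrtr.
have s0 : 0 < Num.sqrt t by apply: lt_le_trans SS.
rewrite /gain gt_eqF // /pos_part le_max; apply/orP; left.
rewrite lerD2l lerN2 -expr_div_n.
have lr : lambda / Num.sqrt t <= r.
  by rewrite ler_pdivrMr // mulrC -ler_pdivrMr.
have l0 : 0 <= lambda / Num.sqrt t by rewrite divr_ge0 ?ltW.
have l1 : lambda / Num.sqrt t <= 1 by apply: le_trans lr _; rewrite ge_min lexx orbT.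
apply: le_trans (_ : lambda / Num.sqrt t <= _).
  by rewrite -[leRHS]expr1; apply: ler_wiXn2l.
by apply: le_trans lr _; rewrite ge_min lexx.
Qed.

End Gain.

Definition shrinkage (R : realType) (n : nat) (w : 'I_n -> 'cV[R]_n) (g : R -> R)
    (y : 'cV[R]_n) : 'cV[R]_n :=
  \col_i (y i 0 * g (energy (w i) y)).

Lemma wg_lassoE (R : realType) (n : nat) (w : 'I_n -> 'cV[R]_n) (lambda : R) :
  wg_lasso w lambda = shrinkage w (gain 1 lambda).
Proof.
apply/funext => y; apply/colP => i; rewrite !mxE norm2_dweight /gain !expr1.
by case: ifP => // _; rewrite mulr0.
Qed.

Lemma pewE (R : realType) (n : nat) (w : 'I_n -> 'cV[R]_n) (lambda : R) :
  pew w lambda = shrinkage w (gain 2 lambda).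
Proof.
apply/funext => y; apply/colP => i; rewrite !mxE norm2_dweight /gain.
by case: ifP => // _; rewrite mulr0.
Qed.

(** * Rectangles in a coordinate plane *)

Lemma long_side (R : realType) (a b T : R) : 0 < a -> 0 < b -> 0 < T ->
  exists M H : R, [/\ 0 < M, M < H, T <= b * M ^+ 2 &
    a * M ^+ 2 + b * (M + M) ^+ 2 < a * H ^+ 2 + b * M ^+ 2].
Proof.
move=> a0 b0 T_gt0; pose M := 1 + T / b.
have M1 : 1 < M by rewrite ltrDl divr_gt0.
have M0 : 0 < M by apply: lt_trans M1.
(* The last inequality asks for [a * H ^+ 2] to exceed [a * M ^+ 2] by more than [3 * b * M ^+ 2];
   the cross term of the square already supplies [6 * b * M ^+ 2]. *)
exists M, (M * (1 + 3 * b / a)); split => //.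
- by rewrite mulrDr mulr1 ltrDl !mulr_gt0 // invr_gt0.
- have -> : T = b * (M - 1) by rewrite /M; field; rewrite gt_eqF.
  by rewrite ler_pM2l //; clearbody M; nra.
have -> : a * (M * (1 + 3 * b / a)) ^+ 2 =
    a * M ^+ 2 + M ^+ 2 * (6 * b) + M ^+ 2 * (9 * b ^+ 2 / a).
  by field; rewrite gt_eqF.
have : 0 < M ^+ 2 * (9 * b ^+ 2 / a).
  by rewrite mulr_gt0 ?exprn_gt0 // divr_gt0 // mulr_gt0 // exprn_gt0.
have : 0 < M ^+ 2 * b by rewrite mulr_gt0 // exprn_gt0.
by clearbody M; lra.
Qed.

Section Shrinkage.
Variables (R : realType) (n : nat) (w : 'I_n -> 'cV[R]_n).
Variables (g : R -> R) (T0 : R).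
Hypotheses (T0_gt0 : 0 < T0) (g_le1 : forall t, g t <= 1).
Hypothesis g_lt : forall t t', T0 <= t -> t < t' -> g t < g t'.
Hypothesis g_near1 : forall eps : R, 0 < eps ->
  exists2 T : R, 0 < T & forall t : R, T <= t -> 1 - eps <= g t.
Hypothesis w_diag : forall i, i \in supp (w i).
Variable psi : 'cV[R]_n -> R.
Hypothesis psi_sub : forall y z : 'cV[R]_n,
  psi y + \sum_l shrinkage w g y l 0 * (z l 0 - y l 0) <= psi z.

Section Plane.
Variables (i j : 'I_n) (M L : R).
Hypothesis ij : i != j.

Definition plane_point (s t : R) : 'cV[R]_n :=
  \col_l (if l == i then s else if l == j then t
          else if l \in supp (w j) then M else L).

Definition rest (k : 'I_n) : R :=
  \sum_(l | (l != i) && (l != j))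
    (w k l 0 * (if l \in supp (w j) then M else L)) ^+ 2.

Lemma energy_plane (k : 'I_n) (s t : R) :
  energy (w k) (plane_point s t) =
  w k i 0 ^+ 2 * s ^+ 2 + w k j 0 ^+ 2 * t ^+ 2 + rest k.
Proof.
rewrite /energy (bigD1 i) //= (bigD1 j) 1?eq_sym //= addrA !mxE !eqxx.
rewrite eq_sym (negbTE ij) !exprMn; congr (_ + _).
by apply: eq_bigr => l /andP[/negbTE li /negbTE lj]; rewrite mxE li lj.
Qed.

Lemma psi_plane (s t s' t' : R) :
  psi (plane_point s t) +
    (s * g (energy (w i) (plane_point s t)) * (s' - s) +
     t * g (energy (w j) (plane_point s t)) * (t' - t)) <=
  psi (plane_point s' t').
Proof.
have := psi_sub (plane_point s t) (plane_point s' t').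
rewrite (bigD1 i) //= (bigD1 j) 1?eq_sym //= big1 ?addr0; last first.
  by move=> l /andP[/negbTE li /negbTE lj]; rewrite !mxE li lj subrr mulr0.
by rewrite !mxE !eqxx eq_sym (negbTE ij).
Qed.

Lemma rest_ge0 (k : 'I_n) : 0 <= rest k.
Proof. by apply: sumr_ge0 => l _; exact: sqr_ge0. Qed.

End Plane.

Lemma rest_own (i j : 'I_n) (M L L' : R) : rest i j M L j = rest i j M L' j.
Proof.
apply: eq_bigr => l _; case: ifPn => //.
by rewrite inE negbK => /eqP ->; rewrite !mul0r.
Qed.

(* The side [H - M] is so long that moving the [i]-th coordinate along it raises
   [energy (w j)] more than moving the [j]-th coordinate from [M] to [2 M] does;
   hence [c] only needs the strict monotonicity of [g], and no compactness. *)
Lemma own_variation (i j : 'I_n) : i != j -> i \in supp (w j) ->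
  exists M H c : R, [/\ 0 < M, M < H, 0 < c &
    forall L t, M <= t <= M + M ->
      c <= t * g (energy (w j) (plane_point i j M L H t)) -
           t * g (energy (w j) (plane_point i j M L M t))].
Proof.
move=> ij; rewrite inE => wji.
have := w_diag j; rewrite inE => wjj.
pose a := w j i 0 ^+ 2; pose b := w j j 0 ^+ 2.
have a0 : 0 < a by rewrite exprn_even_gt0.
have b0 : 0 < b by rewrite exprn_even_gt0.
have [M [H [M0 MH bM aH]]] := long_side a0 b0 T0_gt0.
pose A := rest i j M M j.
have A0 : 0 <= A by exact: rest_ge0.
have g_le t t' : T0 <= t -> t <= t' -> g t <= g t'.
  by move=> h; rewrite le_eqVlt => /predU1P[-> //|/(g_lt h)/ltW].
have aM : 0 < a * M ^+ 2 by rewrite mulr_gt0 // exprn_gt0.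
have bM0 : 0 <= b * M ^+ 2 by exact: ltW (lt_le_trans T0_gt0 bM).
pose gap := g (a * H ^+ 2 + b * M ^+ 2 + A)
  - g (a * M ^+ 2 + b * (M + M) ^+ 2 + A).
have gap0 : 0 < gap.
  by rewrite subr_gt0; apply: g_lt; [clearbody a b A; lra|rewrite ltrD2r].
(* The factor [t] is at least [M]. The gain at [H] is smallest for [t = M] and the gain at [M]
   largest for [t = M + M]; their difference is [gap]. *)
exists M, H, (M * gap); split => //; first by rewrite mulr_gt0.
move=> L t /andP[Mt tM]; move: gap0.
rewrite !energy_plane // (rest_own i j M L M) -/a -/b -/A -mulrBr.
rewrite /gap; clearbody a b A => gap0.
have bt1 : b * M ^+ 2 <= b * t ^+ 2 by rewrite ler_pM2l // lerXn2r ?nnegrE //; lra.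
have bt2 : b * t ^+ 2 <= b * (M + M) ^+ 2.
  by rewrite ler_pM2l // lerXn2r ?nnegrE //; lra.
apply: ler_pM => //; first exact: ltW.
  exact: ltW.
by apply: lerB; apply: g_le; lra.
Qed.

Lemma supp_shrinkage (i j : 'I_n) : i \in supp (w j) ->
  j \in supp (w i) /\ supp (w i) \subset supp (w j).
Proof.
have [-> //|ij] := eqVneq i j; move=> iNj.
have [M [H [c [M0 MH c0 hc]]]] := own_variation ij iNj.
have MM : M <= M + M by lra.
have cM : 0 < c * (M + M - M) by rewrite addrK mulr_gt0.
have loop L cP (hP : forall s, M <= s <= H ->
    s * g (energy (w i) (plane_point i j M L s (M + M))) -
    s * g (energy (w i) (plane_point i j M L s M)) <= cP) :
    c * (M + M - M) <= cP * (H - M).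
  exact: (subgradient_rectangle (ltW MH) MM (psi_plane M L ij) hP (hc L)).
split.
  (* If [w i j 0 = 0], then [energy (w i)] does not vary with [t], and [loop] holds with
     [cP = 0]. *)
  apply/negPn/negP; rewrite inE negbK => /eqP wij.
  suff /(loop M) : forall s, M <= s <= H ->
      s * g (energy (w i) (plane_point i j M M s (M + M))) -
      s * g (energy (w i) (plane_point i j M M s M)) <= 0.
    by rewrite mul0r leNgt cM.
  by move=> s _; rewrite !energy_plane // wij expr0n /= !mul0r subrr.
apply/fintype.subsetP => l lNi; apply/negPn/negP => lNj.
have H0 : 0 < H by lra.
(* With this [eps] the upper bound [H * eps * (H - M)] equals [c * M * (1 - M / H)], which is less
   than [c * M]. *)
have eps0 : 0 < c * M / H ^+ 2 by rewrite divr_gt0 ?mulr_gt0 ?exprn_gt0.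
have [T T_gt0 hT] := g_near1 eps0.
have wil0 : 0 < w i l 0 ^+ 2 by rewrite exprn_even_gt0 //; move: lNi; rewrite inE.
(* Since [L ^+ 2 >= L - 1], the coordinate [l] alone contributes at least [T] to [energy (w i)]. *)
pose L := 1 + T / w i l 0 ^+ 2.
have li : l != i by apply: contraNneq lNj => ->.
have lj : l != j by apply: contraNneq lNj => ->.
have rT : T <= rest i j M L i.
  rewrite /rest (bigD1 l) /= ?li // (negbTE lNj).
  apply: le_trans (_ : (w i l 0 * L) ^+ 2 <= _); last first.
    by rewrite lerDl sumr_ge0 // => k _; exact: sqr_ge0.
  have L1 : 1 < L by rewrite ltrDl divr_gt0.
  have -> : T = w i l 0 ^+ 2 * (L - 1).
    by rewrite /L; field; move: lNi; rewrite inE.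
  by rewrite exprMn ler_pM2l //; nra.
have var s : M <= s <= H ->
    s * g (energy (w i) (plane_point i j M L s (M + M))) -
    s * g (energy (w i) (plane_point i j M L s M)) <= H * (c * M / H ^+ 2).
  move=> /andP[Ms sH].
  (* The two gains differ by at most [eps]: one is at most [1], the other at least [1 - eps]. *)
  set t1 := energy _ _; set t0 := energy _ _.
  have /hT gt0 : T <= t0.
    by rewrite /t0 energy_plane // (le_trans rT) // lerDr addr_ge0 // mulr_ge0 ?sqr_ge0.
  rewrite -mulrBr; apply: le_trans (_ : s * (c * M / H ^+ 2) <= _).
    by rewrite ler_pM2l; [have := g_le1 t1; lra | lra].
  by rewrite ler_pM2r.
have := loop L _ var; apply/negP; rewrite -ltNge.
have -> : H * (c * M / H ^+ 2) * (H - M) = c * M - c * M * (M / H).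
  by field; rewrite gt_eqF.
have -> : M + M - M = M by ring.
by rewrite ltrBlDr ltrDl !mulr_gt0 ?invr_gt0.
Qed.

End Shrinkage.

(** Membership in the supports is symmetric, so the inclusion of [supp_shrinkage] holds both ways; a
    common element [k] then makes both supports equal to [supp (w k)]. *)
Lemma prox_shrinkage_supp (R : realType) (n : nat) (w : 'I_n -> 'cV[R]_n)
    (e : nat) (lambda : R) (phi : 'cV[R]_n -> \bar R) :
  (0 < e)%N -> 0 < lambda -> (forall i, i \in supp (w i)) ->
  is_prox_of (shrinkage w (gain e lambda)) phi ->
  forall i j, supp (w i) :&: supp (w j) != finset.set0 -> supp (w i) = supp (w j).
Proof.
move=> e0 l0 w_diag /prox_subgradient[psi psi_sub].
have nbr := supp_shrinkage (exprn_gt0 2 l0) (gain_le1 e l0) (gain_lt e0 l0)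
  (gain_near1 e0 l0) w_diag psi_sub.
have eq_nbr k i : k \in supp (w i) -> supp (w k) = supp (w i).
  move=> /[dup] /nbr[ik ki] _; apply/eqP; rewrite finset.eqEsubset ki.
  by have [_ ->] := nbr _ _ ik.
move=> i j /finset.set0Pn[k]; rewrite finset.in_setI => /andP[ki kj].
by rewrite -(eq_nbr _ _ ki) (eq_nbr _ _ kj).
Qed.

Theorem corollary8 (R : realType) (n : nat) (hn : (1 <= n)%N)
    (N : 'I_n -> {set 'I_n}) (w : 'I_n -> 'cV[R]_n)
    (w_ge0 : forall i l : 'I_n, 0 <= w i l 0)
    (N_refl : forall i : 'I_n, i \in N i)
    (supp_w : forall i : 'I_n, supp (w i) = N i)
    (lambda : R) (lambda_gt0 : 0 < lambda)
    (overlap : exists i j : 'I_n,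
        N i <> N j /\ (N i :&: N j)%SET <> finset.set0) :
  (~ exists phi : 'cV[R]_n -> \bar R,
       penalty phi /\ is_prox_of (wg_lasso w lambda) phi) /\
  (~ exists phi : 'cV[R]_n -> \bar R,
       penalty phi /\ is_prox_of (pew w lambda) phi).
Proof.
have [i [j [Nij NiNj]]] := overlap.
have w_diag k : k \in supp (w k) by rewrite supp_w.
have not_prox e phi : (0 < e)%N ->
    ~ is_prox_of (shrinkage w (gain e lambda)) phi.
  move=> e0 /(prox_shrinkage_supp e0 lambda_gt0 w_diag)/(_ i j).
  by rewrite !supp_w => H; apply: Nij; apply: H; apply/eqP.
split=> -[phi [_]].
  by rewrite wg_lassoE; exact: not_prox.
by rewrite pewE; exact: not_prox.
Qed.
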